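(* Let $(\mathcal{K},\mathbb{R},\mathbf{T},\alpha)$ be a DG-category over a commutative ring $k$ and let $M$ be a microlinear and Weil exponentiable object of $\mathcal{K}$. Then the canonical projection $\tau_{\mathcal{W}_{D}}(M):M\otimes\mathcal{W}_{D}\rightarrow M$ is a $k$-module object in the slice category $\mathcal{K}/M$, with respect to the following operations, where $M\otimes\mathcal{W}_{D(2)}$ is identified with the product of two copies of $\tau_{\mathcal{W}_D}(M)$ in $\mathcal{K}/M$: (1) addition $\mathrm{id}_{M}\otimes\mathcal{W}_{d\in D\mapsto(d,d)\in D(2)}:M\otimes\mathcal{W}_{D(2)}\rightarrow M\otimes\mathcal{W}_{D}$; (2) zero $\mathrm{id}_{M}\otimes\mathcal{W}_{D\to 1}:M=M\otimes\mathcal{W}_{1}\rightarrow M\otimes\mathcal{W}_{D}$; (3) additive inverse $\mathrm{id}_{M}\otimes\mathcal{W}_{d\in D\mapsto -d\in D}:M\otimes\mathcal{W}_{D}\rightarrow M\otimes\mathcal{W}_{D}$; (4) multiplication by a scalar $\xi\in k$ given by $\mathrm{id}_{M}\otimes\mathcal{W}_{d\in D\mapsto\xi d\in D}:M\otimes\mathcal{W}_{D}\rightarrow M\otimes\mathcal{W}_{D}$.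
   Context: Weil algebras. $k$ is a commutative ring. A Weil $k$-algebra is a commutative $k$-algebra $W$, finitely generated and free as a $k$-module, with a $k$-algebra augmentation $W\to k$ whose kernel is nilpotent (so $W=k\oplus\mathfrak{m}$); $\mathbf{Weil}_k$ is their category (morphisms: augmentation-preserving $k$-algebra homomorphisms). Formal ''infinitesimal objects'' are notation dual to Weil algebras: $\mathcal{W}_{1}=k$, $\mathcal{W}_{D}=k[X]/(X^{2})$, $\mathcal{W}_{D(2)}=k[X_1,X_2]/(X_1^2,X_2^2,X_1X_2)$. A polynomial ''map'' $\varphi:A\to B$ between infinitesimal objects denotes the homomorphism $\mathcal{W}_{\varphi}:\mathcal{W}_{B}\to\mathcal{W}_{A}$ obtained by substitution (e.g. $\mathcal{W}_{d\in D\mapsto(d,d)\in D(2)}:\mathcal{W}_{D(2)}\to\mathcal{W}_{D}$ sends $X_1,X_2\mapsto X$); $\mathcal{W}_{D\to1}:k\to\mathcal{W}_D$ is the unit. DG-category $(\mathcal{K},\mathbb{R},\mathbf{T},\alpha)$: $\mathcal{K}$ is a category with finite limits which is cartesian closed; $\mathbb{R}$ is a commutative $k$-algebra object of $\mathcal{K}$; for each Weil $k$-algebra $W$, $\mathbf{T}^{W}:\mathcal{K}\to\mathcal{K}$ is a left exact functor, with $\mathbf{T}^{k}=\mathrm{id}$ and $\mathbf{T}^{W_2}\circ\mathbf{T}^{W_1}=\mathbf{T}^{W_1\otimes_k W_2}$; for each $\varphi:W_1\to W_2$ in $\mathbf{Weil}_k$, $\alpha_{\varphi}:\mathbf{T}^{W_1}\Rightarrow\mathbf{T}^{W_2}$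 is a natural transformation, functorial in $\varphi$ and compatible with tensor products ($\mathbf{T}^{W}(\alpha_\varphi(X))=\alpha_{\varphi\otimes\mathrm{id}_W}(X)$, $\alpha_{\varphi}(\mathbf{T}^{W}X)=\alpha_{\mathrm{id}_W\otimes\varphi}(X)$); and $\mathbf{T}^{W}\mathbb{R}=\mathbb{R}\otimes_k W$, $\alpha_\varphi(\mathbb{R})=\mathrm{id}_{\mathbb{R}}\otimes\varphi$. Write $X\otimes W:=\mathbf{T}^{W}X$, $f\otimes\mathrm{id}_W:=\mathbf{T}^W f$, $\mathrm{id}_X\otimes\varphi:=\alpha_\varphi(X)$; $\tau_W(X):X\otimes W\to X$ is $\alpha$ of the augmentation $W\to k$. $M$ is microlinear if, for every finite limit diagram in $\mathbf{Weil}_k$, applying $M\otimes(-)$ (and $\alpha_{(-)}(M)$ on arrows) gives a limit diagram in $\mathcal{K}$. $M$ is Weil exponentiable if for all objects $N$ and Weil algebras $W_1,W_2$ the canonical morphism $(M\otimes W_1)^N\otimes W_2\to(M\otimes(W_1\otimes_k W_2))^N$ is an isomorphism (the canonical morphism is the transpose of $(M\otimes W_1)^N\otimes W_2\times N\to((M\otimes W_1)^N\times N)\otimes W_2\to M\otimes(W_1\otimes_k W_2)$ built from $N\to N\otimes W_2$ and evaluation). For microlinear $M$, the two morphisms $\mathrm{id}_M\otimes\mathcal{W}_{d\in D\mapsto(d,0)\in D(2)}$ and $\mathrm{id}_M\otimes\mathcal{W}_{d\in D\mapsto(0,d)\in D(2)}$ exhibit $M\otimes\mathcal{W}_{D(2)}$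 as $(M\otimes\mathcal{W}_D)\times_M(M\otimes\mathcal{W}_D)$, i.e. as the product in $\mathcal{K}/M$; this is the identification used. *)

(* Defs.v *)
From HB Require Import structures.
From mathcomp Require Import all_boot all_algebra.
From mathcomp Require Import boolp.

Set Implicit Arguments.
Unset Strict Implicit.
Unset Printing Implicit Defensive.

Import GRing.Theory.
Local Open Scope ring_scope.

(** MathComp's [algType] excludes the zero ring; a commutative [k]-algebra is
    therefore given here by its structure morphism [k -> A], so that neither [k]
    nor the algebras (e.g. those of generalized points) need be non-trivial. *)
Record calg (k : comPzRingType) := CAlg {
  calg_ring :> comPzRingType;
  calg_in : {rmorphism k -> calg_ring} }.

Record calg_hom (k : comPzRingType) (A B : calg k) := CAlgHom {
  calg_fun :> A -> B;
  calg_homD : {morph calg_fun : x y / x + y};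
  calg_homM : {morph calg_fun : x y / x * y};
  calg_hom_in : forall c : k, calg_fun (calg_in A c) = calg_in B c }.

Section CAlgTheory.
Variable k : comPzRingType.
Implicit Types A B C : calg k.

Lemma calg_hom_eq A B (f g : calg_hom A B) : f =1 g -> f = g.
Proof.
case: f g => [f f1 f2 f3] [g g1 g2 g3] /= /funext fg; subst g.
by congr CAlgHom; apply: Prop_irrelevance.
Qed.

Lemma calg_hom0 A B (f : calg_hom A B) : f 0 = 0.
Proof. by apply: (addrI (f 0)); rewrite -calg_homD !addr0. Qed.

Lemma calg_hom1 A B (f : calg_hom A B) : f 1 = 1.
Proof. by rewrite -(rmorph1 (calg_in A)) calg_hom_in rmorph1. Qed.

Lemma calg_homN A B (f : calg_hom A B) x : f (- x) = - f x.
Proof. by apply: (addrI (f x)); rewrite -calg_homD !subrr calg_hom0. Qed.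

Lemma calg_hom_sum A B (f : calg_hom A B) n (F : 'I_n -> A) :
  f (\sum_i F i) = \sum_i f (F i).
Proof. exact: (big_morph f (@calg_homD _ _ _ f) (calg_hom0 f)). Qed.

Definition calg_id A : calg_hom A A :=
  @CAlgHom k A A id (fun _ _ => erefl) (fun _ _ => erefl) (fun _ => erefl).

Definition calg_comp A B C (g : calg_hom B C) (f : calg_hom A B) :
  calg_hom A C.
Proof.
exists (fun x => g (f x)) => [x y|x y|c].
- by rewrite !calg_homD.
- by rewrite !calg_homM.
- by rewrite !calg_hom_in.
Defined.

Definition calg_base : calg k := @CAlg k k idfun.

Definition calg_unit A : calg_hom calg_base A :=
  @CAlgHom k calg_base A (calg_in A) (rmorphD _) (rmorphM _) (fun _ => erefl).

Definition is_basis A n (b : 'I_n -> A) : Prop :=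
  forall a : A, exists! c : {ffun 'I_n -> k}, a = \sum_i calg_in A (c i) * b i.

End CAlgTheory.

Record weil (k : comPzRingType) := Weil {
  weil_calg :> calg k;
  weil_aug : calg_hom weil_calg (calg_base k);
  weil_free : exists (n : nat) (b : 'I_n -> weil_calg), is_basis b;
  weil_nilp : exists n : nat, forall s : 'I_n -> weil_calg,
    (forall i, weil_aug (s i) = 0) -> \prod_i s i = 0 }.

Record weil_hom (k : comPzRingType) (W1 W2 : weil k) := WeilHom {
  weil_hom_calg :> calg_hom W1 W2;
  weil_hom_aug : forall x, weil_aug W2 (weil_hom_calg x) = weil_aug W1 x }.

Section WeilTheory.
Variable k : comPzRingType.
Implicit Types W : weil k.

Lemma weil_hom_eq W1 W2 (f g : weil_hom W1 W2) : f =1 g -> f = g.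
Proof.
case: f g => [f f1] [g g1] /= /calg_hom_eq fg; subst g.
by congr WeilHom; apply: Prop_irrelevance.
Qed.

Definition weil_id W : weil_hom W W := @WeilHom k W W (calg_id W) (fun _ => erefl).

Definition weil_comp W1 W2 W3 (g : weil_hom W2 W3) (f : weil_hom W1 W2) :
  weil_hom W1 W3.
Proof. by exists (calg_comp g f) => x; rewrite /= !weil_hom_aug. Defined.

Definition weil_base : weil k.
Proof.
exists (calg_base k) (calg_id (calg_base k)).
- exists 1%N, (fun=> 1) => a; exists [ffun=> a].
  split=> [|c]; rewrite big_ord1 ?ffunE mulr1 //= => ->.
  by apply/ffunP=> i; rewrite ffunE (ord1 i).
- by exists 1%N => s /(_ ord0) /= s0; rewrite big_ord1.
Defined.

Definition weil_unit W : weil_hom weil_base W.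
Proof. by exists (calg_unit W) => x; rewrite /= calg_hom_in. Defined.

Definition weil_augm W : weil_hom W weil_base :=
  @WeilHom k W weil_base (weil_aug W) (fun _ => erefl).

(** A basis is chosen only in order to build tensor products; it is not part of
    the structure of a Weil algebra. *)
Definition weil_rank W : nat := sval (cid (weil_free W)).
Definition weil_basis W : 'I_(weil_rank W) -> W :=
  sval (cid (svalP (cid (weil_free W)))).

Lemma weil_basisP W : is_basis (@weil_basis W).
Proof. exact: svalP (cid (svalP (cid (weil_free W)))). Qed.

Definition weil_coord W (w : W) : {ffun 'I_(weil_rank W) -> k} :=
  sval (cid (weil_basisP w)).

Lemma weil_coordK W (w : W) :
  \sum_i calg_in W (weil_coord w i) * weil_basis i = w.
Proof. by case: (svalP (cid (weil_basisP w))). Qed.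

Lemma weil_coord_uniq W (w : W) (c : {ffun 'I_(weil_rank W) -> k}) :
  w = \sum_i calg_in W (c i) * weil_basis i -> weil_coord w = c.
Proof. by case: (svalP (cid (weil_basisP w))) => _ H /H. Qed.

Lemma weil_coordD W (v w : W) i :
  weil_coord (v + w) i = weil_coord v i + weil_coord w i.
Proof.
rewrite (@weil_coord_uniq _ _ [ffun i => weil_coord v i + weil_coord w i]) ?ffunE //.
under eq_bigr do rewrite ffunE rmorphD mulrDl.
by rewrite big_split /= !weil_coordK.
Qed.

Lemma weil_coordZ W (c : k) (w : W) i :
  weil_coord (calg_in W c * w) i = c * weil_coord w i.
Proof.
rewrite (@weil_coord_uniq _ _ [ffun i => c * weil_coord w i]) ?ffunE //.
under eq_bigr do rewrite ffunE rmorphM -mulrA.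
by rewrite -mulr_sumr weil_coordK.
Qed.

End WeilTheory.

(** Carrier of [A (x)_k W]: the family [x] stands for the sum of the
    [x i (x) b_i], where [b] is the chosen basis of [W]; [pure a w] below is
    [a (x) w]. *)
Definition tens (k : comPzRingType) (A : calg k) (W : weil k) : Type :=
  {ffun 'I_(weil_rank W) -> A}.


Section Tensor.
Variables (k : comPzRingType) (A : calg k) (W : weil k).

HB.instance Definition _ := GRing.Zmodule.copy (tens A W) {ffun 'I_(weil_rank W) -> A}.

Implicit Types (x y z : tens A W) (a : A) (v w : W).

Definition pure a w : tens A W := [ffun i => a * calg_in A (weil_coord w i)].

Definition tens_mul x y : tens A W :=
  \sum_i \sum_j pure (x i * y j) (weil_basis i * weil_basis j).

Lemma pureDl w : {morph pure^~ w : a b / a + b}.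
Proof. by move=> a b; apply/ffunP=> i; rewrite !ffunE mulrDl. Qed.

Lemma pureDr a : {morph pure a : v w / v + w}.
Proof.
by move=> v w; apply/ffunP=> i; rewrite !ffunE weil_coordD rmorphD mulrDr.
Qed.

Lemma pure0l w : pure 0 w = 0.
Proof. by apply/ffunP=> i; rewrite !ffunE mul0r. Qed.

Lemma pure0r a : pure a 0 = 0.
Proof. by apply: (addrI (pure a 0)); rewrite -pureDr !addr0. Qed.

Lemma pure_suml n (F : 'I_n -> A) w :
  pure (\sum_i F i) w = \sum_i pure (F i) w.
Proof. exact: (big_morph _ (pureDl w) (pure0l w)). Qed.

Lemma pure_sumr n a (F : 'I_n -> W) :
  pure a (\sum_i F i) = \sum_i pure a (F i).
Proof. exact: (big_morph _ (pureDr a) (pure0r a)). Qed.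

Lemma pureZ (c : k) a w : pure a (calg_in W c * w) = pure (a * calg_in A c) w.
Proof. by apply/ffunP=> i; rewrite !ffunE weil_coordZ rmorphM mulrA. Qed.

Lemma tens_pureE x : x = \sum_i pure (x i) (weil_basis i).
Proof.
apply/ffunP=> j; rewrite sum_ffunE (bigD1 j) //= big1 ?addr0 => [|i ij].
  rewrite ffunE (@weil_coord_uniq _ _ _ [ffun i => (i == j)%:R]).
    by rewrite ffunE eqxx rmorph1 mulr1.
  rewrite (bigD1 j) //= big1 ?addr0 ?ffunE ?eqxx ?rmorph1 ?mul1r // => i ij.
  by rewrite ffunE (negPf ij) rmorph0 mul0r.
rewrite ffunE (@weil_coord_uniq _ _ _ [ffun j => (j == i)%:R]).
  by rewrite ffunE eq_sym (negPf ij) rmorph0 mulr0.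
rewrite (bigD1 i) //= big1 ?addr0 ?ffunE ?eqxx ?rmorph1 ?mul1r // => l li.
by rewrite ffunE (negPf li) rmorph0 mul0r.
Qed.

Lemma tens_mulDl : left_distributive tens_mul +%R.
Proof.
move=> x y z; rewrite /tens_mul -big_split /=; apply: eq_bigr => i _.
rewrite -big_split /=; apply: eq_bigr => j _.
by rewrite ffunE mulrDl pureDl.
Qed.

Lemma tens_mulC : commutative tens_mul.
Proof.
move=> x y; rewrite /tens_mul exchange_big /=.
by apply: eq_bigr => i _; apply: eq_bigr => j _; rewrite mulrC [X in pure _ X]mulrC.
Qed.

Lemma tens_mulDr : right_distributive tens_mul +%R.
Proof. by move=> x y z; rewrite !(tens_mulC x) tens_mulDl. Qed.

Lemma tens_mul0l x : tens_mul 0 x = 0.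
Proof. by apply: (addrI (tens_mul 0 x)); rewrite -tens_mulDl !addr0. Qed.

Lemma tens_mul0r x : tens_mul x 0 = 0.
Proof. by rewrite tens_mulC tens_mul0l. Qed.

Lemma tens_mul_suml n (F : 'I_n -> tens A W) y :
  tens_mul (\sum_i F i) y = \sum_i tens_mul (F i) y.
Proof.
by apply: (big_morph (tens_mul^~ y)) => [u v|]; rewrite ?tens_mulDl ?tens_mul0l.
Qed.

Lemma tens_mul_sumr n (F : 'I_n -> tens A W) y :
  tens_mul y (\sum_i F i) = \sum_i tens_mul y (F i).
Proof.
by apply: (big_morph (tens_mul y)) => [u v|]; rewrite ?tens_mulDr ?tens_mul0r.
Qed.

Lemma tens_mul_pure a b v w :
  tens_mul (pure a v) (pure b w) = pure (a * b) (v * w).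
Proof.
rewrite -{2}(weil_coordK v) -{2}(weil_coordK w) mulr_suml pure_sumr.
rewrite /tens_mul; apply: eq_bigr => i _; rewrite mulr_sumr pure_sumr.
apply: eq_bigr => j _; rewrite !ffunE mulrACA.
by rewrite [in RHS]mulrACA -[in RHS]rmorphM pureZ rmorphM.
Qed.

Lemma tens_ind (P : tens A W -> Prop) :
  (forall a w, P (pure a w)) -> (forall x y, P x -> P y -> P (x + y)) ->
  forall x, P x.
Proof.
move=> Pp PD x; rewrite (tens_pureE x); apply: big_ind => //.
by rewrite -(pure0l 0).
Qed.

Lemma tens_mulA : associative tens_mul.
Proof.
move=> x y z; elim/tens_ind: x => [a u|x x']; last by rewrite !tens_mulDl => -> ->.
elim/tens_ind: y => [b v|y y']; last by rewrite !(tens_mulDl, tens_mulDr) => -> ->.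
elim/tens_ind: z => [c w|z z']; last by rewrite !tens_mulDr => -> ->.
by rewrite !tens_mul_pure !mulrA.
Qed.

Lemma tens_mul1l : left_id (pure 1 1) tens_mul.
Proof.
move=> x; elim/tens_ind: x => [a u|x x']; last by rewrite !tens_mulDr => -> ->.
by rewrite tens_mul_pure !mul1r.
Qed.

HB.instance Definition _ := GRing.Zmodule_isComPzRing.Build (tens A W)
  tens_mulA tens_mulC tens_mul1l tens_mulDl.

Lemma pureM a b v w : pure a v * pure b w = pure (a * b) (v * w).
Proof. exact: tens_mul_pure. Qed.

Definition tens_in (c : k) : tens A W := pure (calg_in A c) 1.

Lemma tens_in_zmod : zmod_morphism tens_in.
Proof. by move=> c d; rewrite /tens_in rmorphB pureDl; congr (_ + _);
 apply/ffunP=> i; rewrite !ffunE mulNr. Qed.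

Lemma tens_in_monoid : monoid_morphism tens_in.
Proof. by split=> [|c d]; rewrite /tens_in ?rmorph1 // rmorphM pureM mulr1. Qed.

HB.instance Definition _ := GRing.isZmodMorphism.Build _ _ tens_in tens_in_zmod.
HB.instance Definition _ := GRing.isMonoidMorphism.Build _ _ tens_in tens_in_monoid.

Definition calg_tens : calg k := @CAlg k (tens A W) tens_in.

Definition tens_inl : calg_hom A calg_tens.
Proof.
exists (fun a => pure a 1) => [a b|a b|c] //.
- exact: pureDl.
- by rewrite pureM mulr1.
Defined.

Definition tens_inr : calg_hom W calg_tens.
Proof.
exists (pure 1) => [v w|v w|c] //.
- exact: pureDr.
- by rewrite pureM mulr1.
- by rewrite -[calg_in W c]mulr1 pureZ mul1r.
Defined.

Lemma pureE a w : pure a w = tens_inl a * tens_inr w.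
Proof. by rewrite /= pureM mul1r mulr1. Qed.

(** [A (x)_k W] is the coproduct of [A] and [W] among commutative [k]-algebras. *)
Section Copair.
Variables (B : calg k) (f : calg_hom A B) (g : calg_hom W B).

Definition copair_fun (x : calg_tens) : B := \sum_i f (x i) * g (weil_basis i).

Lemma copair_funD : {morph copair_fun : x y / x + y}.
Proof.
move=> x y; rewrite /copair_fun -big_split /=; apply: eq_bigr => i _.
by rewrite ffunE calg_homD mulrDl.
Qed.

Lemma copair_pure a w : copair_fun (pure a w) = f a * g w.
Proof.
rewrite -{2}(weil_coordK w) calg_hom_sum mulr_sumr; apply: eq_bigr => i _.
by rewrite ffunE !calg_homM !calg_hom_in mulrA.
Qed.

Definition tens_copair : calg_hom calg_tens B.
Proof.
exists copair_fun => [x y|x y|c].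
- exact: copair_funD.
- elim/tens_ind: x => [a u|x x']; last by rewrite mulrDl !copair_funD mulrDl => -> ->.
  elim/tens_ind: y => [b v|y y']; last by rewrite mulrDr !copair_funD mulrDr => -> ->.
  by rewrite pureM !copair_pure !calg_homM mulrACA.
- by rewrite /= copair_pure calg_hom1 mulr1 calg_hom_in.
Defined.

End Copair.
End Tensor.

(** [id_A (x) f]. *)
Definition calg_tens_map (k : comPzRingType) (A : calg k) (W1 W2 : weil k)
    (f : calg_hom W1 W2) : calg_hom (calg_tens A W1) (calg_tens A W2) :=
  tens_copair (tens_inl A W2) (calg_comp (tens_inr A W2) f).

Section WeilTensor.
Variable k : comPzRingType.
Implicit Types W : weil k.

Section Tens.
Variables W1 W2 : weil k.

Let eps := tens_copair (weil_aug W1) (weil_aug W2).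

Lemma tens_free : exists (n : nat) (b : 'I_n -> calg_tens W1 W2), is_basis b.
Proof.
pose I : finType := ('I_(weil_rank W1) * 'I_(weil_rank W2))%type.
exists #|I|, (fun l => pure (weil_basis (enum_val l).1) (weil_basis (enum_val l).2)).
have E (c : {ffun 'I_#|I| -> k}) :
  \sum_l calg_in (calg_tens W1 W2) (c l) *
     pure (weil_basis (enum_val l).1) (weil_basis (enum_val l).2) =
  [ffun j => \sum_i calg_in W1 (c (enum_rank (i, j))) * weil_basis i] :> tens W1 W2.
  rewrite [RHS]tens_pureE.
  rewrite (reindex (@enum_rank I)) /=; last first.
    by exists enum_val => x _; rewrite ?enum_rankK ?enum_valK.
  under eq_bigr => p _ do rewrite enum_rankK pureM mul1r.
  under [RHS]eq_bigr => j _ do rewrite ffunE pure_suml.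
  by rewrite exchange_big pair_bigA /=; apply: eq_bigr => p _; rewrite -surjective_pairing.
move=> x; exists [ffun l => weil_coord (x (enum_val l).2) (enum_val l).1]; split.
  rewrite E; apply/ffunP=> j; rewrite ffunE -{1}(weil_coordK (x j)).
  by apply: eq_bigr => i _; rewrite ffunE enum_rankK.
move=> c ->; rewrite E; apply/ffunP=> l; rewrite !ffunE.
rewrite (@weil_coord_uniq _ _ _ [ffun i => c (enum_rank (i, (enum_val l).2))]).
  by rewrite ffunE -surjective_pairing enum_valK.
by apply: eq_bigr => i _; rewrite ffunE.
Qed.

Inductive in_pow (W : weil k) : nat -> W -> Prop :=
| InPow0 w : in_pow 0 w
| InPowS n w s : in_pow n w -> weil_aug W s = 0 -> in_pow n.+1 (w * s).

Lemma in_powM (W : weil k) n (w u : W) : in_pow n w -> in_pow n (w * u).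
Proof.
elim=> [{}w|{}n {}w s _ IH s0]; first exact: InPow0.
by rewrite mulrAC; apply: InPowS.
Qed.

Lemma in_powW (W : weil k) m n (w : W) : (m <= n)%N -> in_pow n w -> in_pow m w.
Proof.
elim: m n w => [|m IH] n w mn H; first exact: InPow0.
case: n mn H => [//|n] mn H.
inversion H as [|n' w' s H1 H2]; subst.
by apply: InPowS => //; apply: IH H1.
Qed.

Lemma in_powP (W : weil k) n (w : W) : in_pow n w ->
  exists u (s : 'I_n -> W), (forall i, weil_aug W (s i) = 0) /\ w = u * \prod_i s i.
Proof.
elim=> [{}w|{}n {}w t _ [u [s [s0 ->]]] t0].
  by exists w, (fun=> 0); split=> [[]|] //; rewrite big_ord0 mulr1.
exists u, (fun i => oapp s t (unlift ord_max i)); split=> [i|].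
  by case: unliftP => [j|] _ /=.
rewrite big_ord_recr /= unlift_none /= -mulrA; congr (_ * (_ * _)).
apply: eq_bigr => i _; have -> : widen_ord (leqnSn n) i = lift ord_max i.
  by apply: val_inj; rewrite /= /bump leqNgt ltn_ord.
by rewrite liftK.
Qed.

Inductive in_span : nat -> tens W1 W2 -> Prop :=
| InSpan0 n : in_span n 0
| InSpanD n x y : in_span n x -> in_span n y -> in_span n (x + y)
| InSpanP p q a v : in_pow p a -> in_pow q v -> in_span (p + q) (pure a v).

Lemma in_spanM n x y : in_span n x -> eps y = 0 -> in_span n.+1 (x * y).
Proof.
move=> + y0; elim=> [m|m z z' _ IH _ IH'|p q a v Ha Hv].
- by rewrite mul0r; apply: InSpan0.
- by rewrite mulrDl; apply: InSpanD.
pose w := \sum_i calg_in W2 (weil_aug W1 (y i)) * weil_basis i.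
have -> : y = \sum_i pure (y i - calg_in W1 (weil_aug W1 (y i))) (weil_basis i)
    + pure 1 w.
  rewrite pure_sumr -big_split /= {1}(tens_pureE y); apply: eq_bigr => i _.
  by rewrite pureZ mul1r -pureDl subrK.
have w0 : weil_aug W2 w = 0.
  rewrite -y0 /= calg_hom_sum; apply: eq_bigr => i _.
  by rewrite calg_homM calg_hom_in.
rewrite mulrDr mulr_sumr; apply: InSpanD; last first.
  by rewrite pureM mulr1 -addnS; apply: InSpanP => //; apply: InPowS.
apply: (big_ind (in_span (p + q).+1)) => [|x1 x2|i _].
- exact: InSpan0.
- exact: InSpanD.
- rewrite pureM -addSn; apply: InSpanP; last exact: in_powM.
  by apply: InPowS => //; rewrite calg_homD calg_homN calg_hom_in subrr.
Qed.

Lemma tens_nilp : exists n : nat, forall s : 'I_n -> calg_tens W1 W2,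
  (forall i, eps (s i) = 0) -> \prod_i s i = 0.
Proof.
have [m1 H1] := weil_nilp W1; have [m2 H2] := weil_nilp W2.
exists (m1 + m2)%N.
have S n (s : 'I_n -> calg_tens W1 W2) : (forall i, eps (s i) = 0) ->
    in_span n (\prod_i s i).
  elim: n s => [|n IH] s s0.
    by rewrite big_ord0; apply: (@InSpanP 0 0); apply: InPow0.
  by rewrite big_ord_recr /=; apply: in_spanM => //; apply: IH.
move=> s /S; move En : (m1 + m2)%N (\prod_i s i) => n x Hx.
elim: Hx En => [//|{}n {}x y _ IHx _ IHy En|p q a v Ha Hv En].
  by rewrite IHx // IHy // addr0.
have [le|lt] := leqP m1 p.
  have [u [t [t0 ->]]] := in_powP (in_powW le Ha).
  by rewrite H1 // mulr0 pure0l.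
have le : (m2 <= q)%N.
  by rewrite -(leq_add2l m1) En leq_add2r ltnW.
have [u [t [t0 ->]]] := in_powP (in_powW le Hv).
by rewrite H2 // mulr0 pure0r.
Qed.

Definition weil_tens : weil k := @Weil k (calg_tens W1 W2) eps tens_free tens_nilp.

Definition weil_inl : weil_hom W1 weil_tens.
Proof. by exists (tens_inl W1 W2) => x; rewrite /= copair_pure calg_hom1 mulr1. Defined.

Definition weil_inr : weil_hom W2 weil_tens.
Proof. by exists (tens_inr W1 W2) => x; rewrite /= copair_pure calg_hom1 mul1r. Defined.

Definition weil_copair W (f : weil_hom W1 W) (g : weil_hom W2 W) : weil_hom weil_tens W.
Proof.
exists (tens_copair f g) => x; rewrite /= calg_hom_sum; apply: eq_bigr => i _.
by rewrite calg_homM !weil_hom_aug.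
Defined.
End Tens.

(** [f (x) g]. *)
Definition weil_map W1 W2 V1 V2 (f : weil_hom W1 V1) (g : weil_hom W2 V2) :
  weil_hom (weil_tens W1 W2) (weil_tens V1 V2) :=
  weil_copair (weil_comp (weil_inl V1 V2) f) (weil_comp (weil_inr V1 V2) g).

Definition weil_assoc W1 W2 W3 :
  weil_hom (weil_tens (weil_tens W1 W2) W3) (weil_tens W1 (weil_tens W2 W3)) :=
  weil_copair
    (weil_copair (weil_inl _ _) (weil_comp (weil_inr _ _) (weil_inl W2 W3)))
    (weil_comp (weil_inr _ _) (weil_inr W2 W3)).

Definition weil_unitl W : weil_hom (weil_tens (weil_base k) W) W :=
  weil_copair (weil_unit W) (weil_id W).

Definition weil_unitr W : weil_hom (weil_tens W (weil_base k)) W :=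
  weil_copair (weil_id W) (weil_unit W).

End WeilTensor.

(** The Weil algebra of [D(n)], i.e. [k[X_1, ..., X_n] / (X_i X_j)_(i, j)], with
    [(a, v)] standing for [a + \sum_j v_j X_j] (lemma [WDE]); its presentation is
    [WD_subst] with [WD_substX].  [D] is [D(1)] and [1] is the one-point object
    with Weil algebra [k = weil_base]. *)
Definition WD_type (k : comPzRingType) (n : nat) : Type := (k * 'rV[k]_n)%type.

Section WD.
Variables (k : comPzRingType) (n : nat).

HB.instance Definition _ := GRing.Zmodule.copy (WD_type k n) (k * 'rV[k]_n)%type.

Implicit Types x y z : WD_type k n.

Definition WD_mul x y : WD_type k n := (x.1 * y.1, x.1 *: y.2 + y.1 *: x.2).
Definition WD_one : WD_type k n := (1, 0).

Lemma WD_mulA : associative WD_mul.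
Proof.
move=> [a u] [b v] [c w]; rewrite /WD_mul /=; congr pair; first exact: mulrA.
by rewrite !scalerDr !scalerA addrA (mulrC c a) (mulrC c b).
Qed.

Lemma WD_mulC : commutative WD_mul.
Proof. by move=> [a u] [b v]; rewrite /WD_mul /= mulrC addrC. Qed.

Lemma WD_mul1l : left_id WD_one WD_mul.
Proof. by move=> [a u]; rewrite /WD_mul /= mul1r scale1r scaler0 addr0. Qed.

Lemma WD_mulDl : left_distributive WD_mul +%R.
Proof.
move=> [a u] [b v] [c w]; rewrite /WD_mul /=; congr pair; first exact: mulrDl.
by rewrite scalerDl scalerDr addrACA.
Qed.

HB.instance Definition _ := GRing.Zmodule_isComPzRing.Build (WD_type k n)
  WD_mulA WD_mulC WD_mul1l WD_mulDl.

Definition WD_in (c : k) : WD_type k n := (c, 0).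

Lemma WD_in_zmod : zmod_morphism WD_in.
Proof. by move=> c d; congr pair; rewrite subrr. Qed.

Lemma WD_in_monoid : monoid_morphism WD_in.
Proof. by split=> // c d; congr pair; rewrite !scaler0 addr0. Qed.

HB.instance Definition _ := GRing.isZmodMorphism.Build _ _ WD_in WD_in_zmod.
HB.instance Definition _ := GRing.isMonoidMorphism.Build _ _ WD_in WD_in_monoid.

Definition WD_calg : calg k := @CAlg k (WD_type k n) WD_in.

Definition WD_aug : calg_hom WD_calg (calg_base k) :=
  @CAlgHom k WD_calg (calg_base k) fst
    (fun _ _ => erefl) (fun _ _ => erefl) (fun _ => erefl).

Definition WD_X (j : 'I_n) : WD_calg := (0, delta_mx 0 j).

Lemma WD_XX i j : WD_X i * WD_X j = 0.
Proof. by congr pair; rewrite /= ?mul0r // !scale0r addr0. Qed.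

Lemma WD_inE c x : calg_in WD_calg c * x = (c * x.1, c *: x.2).
Proof. by congr pair; rewrite /= scaler0 addr0. Qed.

Lemma WD_sum (I : finType) (F : I -> WD_calg) :
  \sum_i F i = (\sum_i (F i).1, \sum_i (F i).2).
Proof. by elim/big_rec3: _ => // i x y _ _ ->; case: (F i). Qed.

Lemma WD_free : exists (m : nat) (b : 'I_m -> WD_calg), is_basis b.
Proof.
pose b (i : 'I_n.+1) := oapp WD_X 1 (unlift ord0 i).
have E (c : {ffun 'I_n.+1 -> k}) : \sum_i calg_in WD_calg (c i) * b i =
    (c ord0, \row_j c (lift ord0 j)).
  rewrite big_ord_recl /b unlift_none WD_inE /= mulr1 scaler0.
  under eq_bigr do rewrite liftK WD_inE /= mulr0.
  rewrite WD_sum /= big1 //; congr pair; rewrite /= ?addr0 // add0r.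
  by rewrite [RHS]row_sum_delta; apply: eq_bigr => j _; rewrite mxE.
exists n.+1; exists b => -[a v].
exists [ffun i => oapp (v 0) a (unlift ord0 i)]; split.
  rewrite E ffunE unlift_none /=; congr pair; apply/rowP=> j.
  by rewrite mxE ffunE liftK.
move=> c; rewrite E => -[-> ->]; apply/ffunP=> i; rewrite ffunE.
by case: unliftP => [j|] -> /=; rewrite ?mxE.
Qed.

Lemma WD_nilp : exists m : nat, forall s : 'I_m -> WD_calg,
  (forall i, WD_aug (s i) = 0) -> \prod_i s i = 0.
Proof.
exists 2%N => s s0; rewrite big_ord_recl big_ord1.
have := s0 ord0; have := s0 (lift ord0 ord0).
case: (s ord0) (s (lift ord0 ord0)) => [a u] [b v] /= -> ->.
by congr pair; rewrite /= ?mul0r // !scale0r addr0.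
Qed.

Definition WD : weil k := @Weil k WD_calg WD_aug WD_free WD_nilp.

Lemma WDE (x : WD) : x = calg_in WD x.1 + \sum_j calg_in WD (x.2 0 j) * WD_X j.
Proof.
case: x => a v /=; under eq_bigr do rewrite WD_inE /= mulr0.
rewrite WD_sum /= big1 //; congr pair; rewrite /= ?addr0 // add0r.
exact: row_sum_delta.
Qed.

Section Subst.
Variables (W : weil k) (y : 'I_n -> W).
Hypotheses (yy : forall i j, y i * y j = 0) (y_aug : forall j, weil_aug W (y j) = 0).

Definition WD_subst_fun (x : WD) : W :=
  calg_in W x.1 + \sum_j calg_in W (x.2 0 j) * y j.

Lemma WD_substD : {morph WD_subst_fun : x x' / x + x'}.
Proof.
move=> x x'; rewrite /WD_subst_fun /= rmorphD addrACA -big_split /=.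
by congr (_ + _); apply: eq_bigr => j _; rewrite mxE rmorphD mulrDl.
Qed.

Lemma WD_substM : {morph WD_subst_fun : x x' / x * x'}.
Proof.
move=> x x'; rewrite /WD_subst_fun /= rmorphM mulrDl !mulrDr -!addrA; congr (_ + _).
rewrite addrA [X in _ = _ + X](_ : _ = 0) ?addr0; last first.
  rewrite mulr_suml big1 // => i _; rewrite mulr_sumr big1 // => j _.
  by rewrite mulrACA yy mulr0.
rewrite mulr_suml mulr_sumr -big_split /=; apply: eq_bigr => j _.
rewrite !mxE rmorphD !rmorphM mulrDl mulrA; congr (_ + _).
by rewrite -mulrA mulrC.
Qed.

Lemma WD_subst_in c : WD_subst_fun (calg_in WD c) = calg_in W c.
Proof.
by rewrite /WD_subst_fun /= big1 ?addr0 // => j _; rewrite mxE rmorph0 mul0r.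
Qed.

Lemma WD_subst_aug x : weil_aug W (WD_subst_fun x) = weil_aug WD x.
Proof.
rewrite calg_homD calg_hom_in calg_hom_sum big1 ?addr0 // => j _.
by rewrite calg_homM y_aug mulr0.
Qed.

Definition WD_subst : weil_hom WD W :=
  @WeilHom k WD W (CAlgHom WD_substD WD_substM WD_subst_in) WD_subst_aug.

Lemma WD_substX j : WD_subst (WD_X j) = y j.
Proof.
rewrite /= /WD_subst_fun /= rmorph0 add0r (bigD1 j) //= big1 ?addr0 => [|i ij].
  by rewrite mxE !eqxx rmorph1 mul1r.
by rewrite mxE (negPf ij) andbF rmorph0 mul0r.
Qed.

End Subst.

End WD.

Section Linear.
Variables (k : comPzRingType) (n : nat) (c : 'I_n -> k).

Let y (j : 'I_n) : WD k 1 := calg_in (WD k 1) (c j) * WD_X k ord0.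

Lemma WD_lin_nil i j : y i * y j = 0.
Proof. by rewrite /y mulrACA WD_XX mulr0. Qed.

Lemma WD_lin_aug j : weil_aug (WD k 1) (y j) = 0.
Proof. by rewrite /= mulr0. Qed.

(** The homomorphism dual to the polynomial map
    [d : D |-> (c_0 d, ..., c_(n-1) d) : D(n)], i.e. the substitution
    [X_j |-> c_j X]. *)
Definition WD_lin : weil_hom (WD k n) (WD k 1) := WD_subst WD_lin_nil WD_lin_aug.

Lemma WD_linX j : WD_lin (WD_X k j) = calg_in (WD k 1) (c j) * WD_X k ord0.
Proof. exact: WD_substX. Qed.

End Linear.

Record category := Category {
  obj :> Type;
  mor : obj -> obj -> Type;
  idm : forall x, mor x x;
  cat_comp : forall x y z, mor y z -> mor x y -> mor x z;
  cat_comp1m : forall x y (f : mor x y), cat_comp (idm y) f = f;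
  cat_compm1 : forall x y (f : mor x y), cat_comp f (idm x) = f;
  cat_compA : forall x y z t (h : mor z t) (g : mor y z) (f : mor x y),
    cat_comp h (cat_comp g f) = cat_comp (cat_comp h g) f }.

Arguments mor {c} x y : rename.
Arguments idm {c} x : rename.
Arguments cat_comp {c x y z} g f : rename.
Notation "g \oc f" := (cat_comp g f) (at level 40, left associativity).

Record functor (C D : category) := Functor {
  fobj :> C -> D;
  fmap : forall x y : C, mor x y -> mor (fobj x) (fobj y);
  fmap1 : forall x, fmap (idm x) = idm (fobj x);
  fmapM : forall x y z (g : mor y z) (f : mor x y),
    fmap (g \oc f) = fmap g \oc fmap f }.

Arguments fmap {C D} f {x y} _ : rename.

Record nat_trans (C D : category) (F G : functor C D) := NatTrans {
  nat_fun :> forall x : C, mor (F x) (G x);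
  nat_funP : forall (x y : C) (f : mor x y),
    nat_fun y \oc fmap F f = fmap G f \oc nat_fun x }.

Definition inverse_of (C : category) (x y : C) (f : mor x y) (g : mor y x) : Prop :=
  g \oc f = idm x /\ f \oc g = idm y.

Definition is_iso (C : category) (x y : C) (f : mor x y) : Prop :=
  exists g, inverse_of f g.

Definition functor_id (C : category) : functor C C :=
  @Functor C C id (fun _ _ f => f) (fun _ => erefl) (fun _ _ _ _ _ => erefl).

Definition functor_comp (C D E : category) (G : functor D E) (F : functor C D) :
  functor C E.
Proof.
exists (fun x => G (F x)) (fun x y f => fmap G (fmap F f)) => [x|x y z g f].
- by rewrite !fmap1.
- by rewrite !fmapM.
Defined.

Record cone (J C : category) (F : functor J C) := Cone {
  apex : C;
  leg : forall j : J, mor apex (F j);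
  legP : forall (i j : J) (u : mor i j), fmap F u \oc leg i = leg j }.

Definition is_limit (J C : category) (F : functor J C) (c : cone F) : Prop :=
  forall c' : cone F,
    exists! h : mor (apex c') (apex c), forall j, leg c j \oc h = leg c' j.

Definition map_cone (J C D : category) (G : functor C D) (F : functor J C)
  (c : cone F) : cone (functor_comp G F).
Proof.
exists (G (apex c)) (fun j => fmap G (leg c j)) => i j u /=.
by rewrite -fmapM legP.
Defined.

Definition finite_type (T : Type) : Prop := 
  exists (n : nat) (s : 'I_n -> T), forall x, exists i, s i = x.

Definition finite_category (J : category) : Prop :=
  finite_type J /\ forall i j : J, finite_type (mor i j).

Definition has_finite_limits (C : category) : Prop :=
  forall J : category, finite_category J ->
  forall F : functor J C, exists c : cone F, is_limit c.

Definition left_exact (C D : category) (G : functor C D) : Prop :=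
  forall J : category, finite_category J ->
  forall (F : functor J C) (c : cone F), is_limit c -> is_limit (map_cone G c).

(** Chosen finite products. *)
Record finite_products (C : category) := FiniteProducts {
  term : C;
  bang : forall x, mor x term;
  bang_uniq : forall x (f g : mor x term), f = g;
  cprod : C -> C -> C;
  pr1 : forall x y, mor (cprod x y) x;
  pr2 : forall x y, mor (cprod x y) y;
  cpair : forall z x y, mor z x -> mor z y -> mor z (cprod x y);
  pr1_pair : forall z x y (f : mor z x) (g : mor z y), pr1 x y \oc cpair f g = f;
  pr2_pair : forall z x y (f : mor z x) (g : mor z y), pr2 x y \oc cpair f g = g;
  pair_uniq : forall z x y (f g : mor z (cprod x y)),
    pr1 x y \oc f = pr1 x y \oc g -> pr2 x y \oc f = pr2 x y \oc g -> f = g }.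

Arguments term {C} f : rename.
Arguments bang {C} f x : rename.
Arguments cprod {C} f x y : rename.
Arguments pr1 {C f x y} : rename.
Arguments pr2 {C f x y} : rename.
Arguments cpair {C f z x y} _ _ : rename.

Definition prod_map (C : category) (P : finite_products C) (x y x' y' : C)
    (f : mor x x') (g : mor y y') : mor (cprod P x y) (cprod P x' y') :=
  cpair (f \oc pr1) (g \oc pr2).

(** Chosen exponentials; [cexp x n] is [x ^ n]. *)
Record exponentials (C : category) (P : finite_products C) := Exponentials {
  cexp : C -> C -> C;
  ev : forall x n, mor (cprod P (cexp x n) n) x;
  cat_curry : forall z n x, mor (cprod P z n) x -> mor z (cexp x n);
  ev_curry : forall z n x (f : mor (cprod P z n) x),
    ev x n \oc prod_map P (cat_curry f) (idm n) = f;
  curry_uniq : forall z n x (g h : mor z (cexp x n)),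
    ev x n \oc prod_map P g (idm n) = ev x n \oc prod_map P h (idm n) -> g = h }.

Arguments cexp {C P} e x n : rename.
Arguments ev {C P} e x n : rename.
Arguments cat_curry {C P} e {z n x} f : rename.

Section Discrete.

Definition discrete2 : category.
Proof.
exists bool (fun i j => i = j) (fun i => erefl) (fun i j l v u => etrans u v).
- by move=> i j u; apply: Prop_irrelevance.
- by move=> i j u; apply: Prop_irrelevance.
- by move=> i j l m h g f; apply: Prop_irrelevance.
Defined.

Lemma discrete2_finite : finite_category discrete2.
Proof.
split.
  exists 2%N; exists (fun i : 'I_2 => i == ord0) => -[]; first by exists ord0.
  by exists ord_max.
move=> i j; have [e|ne] := boolP (i == j :> bool).
  exists 1%N; exists (fun=> eqP e) => u; exists ord0; exact: (@Prop_irrelevance (i = j)).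
by exists 0%N; exists (fun i : 'I_0 => match i with Ordinal _ h => False_rect _ (notF h) end)
  => u; rewrite u eqxx in ne.
Qed.

Variable C : category.

Definition diag2 (x y : C) : functor discrete2 C.
Proof.
exists (fun b : bool => if b then x else y)
  (fun i j u => ecast j (mor (if i then x else y) (if j then x else y)) u (idm _)).
- by [].
- by move=> i j l g f; case: l / g; case: j / f; rewrite /= cat_comp1m.
Defined.

Definition cone2 (x y z : C) (f : mor z x) (g : mor z y) : cone (diag2 x y).
Proof.
exists z (fun b : bool => match b return mor z (if b then x else y) with
                          | true => f | false => g end).
by move=> i j u; case: j / u; rewrite /= cat_comp1m.
Defined.

Lemma lex_prod (D : category) (P : finite_products C) (F : functor C D) (x y : C) (z : D) :
  left_exact F -> forall (f : mor z (F x)) (g : mor z (F y)),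
  exists! h : mor z (F (cprod P x y)), fmap F pr1 \oc h = f /\ fmap F pr2 \oc h = g.
Proof.
move=> lexF f g.
have lim : is_limit (@cone2 x y (cprod P x y) pr1 pr2).
  move=> c'; exists (cpair (leg c' true) (leg c' false)).
  split=> [[]|h hP] /=; rewrite ?pr1_pair ?pr2_pair //.
  by apply: pair_uniq; rewrite ?pr1_pair ?pr2_pair -?(hP true) -?(hP false).
have legsP (i j : discrete2) (u : mor i j) : fmap (functor_comp F (diag2 x y)) u \oc
    (match i return mor z (F (diag2 x y i)) with true => f | false => g end) =
    match j return mor z (F (diag2 x y j)) with true => f | false => g end.
  by case: j / u; rewrite /= fmap1 cat_comp1m.
have [h [hP hU]] := lexF _ discrete2_finite _ _ lim (Cone legsP).
exists h; split; first by split; [exact: (hP true) | exact: (hP false)].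
by move=> h' [h1 h2]; apply: hU => -[].
Qed.

End Discrete.

(** A left exact [F] turns a product into a product: this is the pairing into
    [F (x * y)] that inverts the comparison morphism [F (x * y) -> F x * F y]. *)
Definition lex_pair (C D : category) (P : finite_products C) (F : functor C D)
    (lexF : left_exact F) (x y : C) (z : D) (f : mor z (F x)) (g : mor z (F y)) :
  mor z (F (cprod P x y)) := sval (cid (lex_prod P lexF f g)).

Section Slice.
Variables (C : category) (m : C).

Record slice_obj := SliceObj { slice_dom : C; slice_map : mor slice_dom m }.

Record slice_hom (x y : slice_obj) := SliceHom {
  slice_fun : mor (slice_dom x) (slice_dom y);
  slice_funP : slice_map y \oc slice_fun = slice_map x }.

Lemma slice_hom_eq x y (f g : slice_hom x y) : slice_fun f = slice_fun g -> f = g.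
Proof.
case: f g => [f fP] [g gP] /= fg; subst g; congr SliceHom; exact: Prop_irrelevance.
Qed.

Definition slice_id x : slice_hom x x := SliceHom (cat_compm1 (slice_map x)).

Definition slice_comp x y z (g : slice_hom y z) (f : slice_hom x y) : slice_hom x z.
Proof. by exists (slice_fun g \oc slice_fun f); rewrite cat_compA !slice_funP. Defined.

Definition slice : category.
Proof.
exists slice_obj slice_hom slice_id slice_comp.
- by move=> x y f; apply: slice_hom_eq; apply: cat_comp1m.
- by move=> x y f; apply: slice_hom_eq; apply: cat_compm1.
- by move=> x y z t h g f; apply: slice_hom_eq; apply: cat_compA.
Defined.

End Slice.

Section Pullbacks.

Record pullback (C : category) (x y m : C) (p : mor x m) (q : mor y m) := Pullback {
  pb : C;
  pb1 : mor pb x;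
  pb2 : mor pb y;
  pbP : p \oc pb1 = q \oc pb2;
  pb_pair : forall z (f : mor z x) (g : mor z y), p \oc f = q \oc g -> mor z pb;
  pb1_pair : forall z (f : mor z x) (g : mor z y) e, pb1 \oc @pb_pair z f g e = f;
  pb2_pair : forall z (f : mor z x) (g : mor z y) e, pb2 \oc @pb_pair z f g e = g;
  pb_uniq : forall z (f g : mor z pb),
    pb1 \oc f = pb1 \oc g -> pb2 \oc f = pb2 \oc g -> f = g }.

Definition cospan_hom (i j : option bool) : Type :=
  if j is Some _ then i = j else unit.

Definition cospan_id (i : option bool) : cospan_hom i i :=
  match i with Some b => erefl | None => tt end.

Definition cospan_comp (i j l : option bool) :
  cospan_hom j l -> cospan_hom i j -> cospan_hom i l.
Proof. by case: l => [b|] //= ->. Defined.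

Lemma cospan_hom_uniq (i j : option bool) (u v : cospan_hom i j) : u = v.
Proof. by case: j u v => [b|] /= u v; [apply: Prop_irrelevance | case: u v => -[]]. Qed.

Definition cospan : category.
Proof.
by exists (option bool) cospan_hom cospan_id cospan_comp => *; apply: cospan_hom_uniq.
Defined.

Lemma cospan_finite : finite_category cospan.
Proof.
split.
  exists 3%N; exists (fun i : 'I_3 => nth None [:: Some true; Some false; None] i).
  case=> [[]|]; first by exists (inord 0); rewrite inordK.
    by exists (inord 1); rewrite inordK.
  by exists (inord 2); rewrite inordK.
move=> i j; case: (pselect (exists u : mor i j, True)) => [[u _]|nu].
  by exists 1%N; exists (fun=> u) => v; exists ord0; apply: cospan_hom_uniq.
by exists 0%N; exists (fun i : 'I_0 => match i with Ordinal _ h => False_rect _ (notF h) end)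
  => u; case: nu; exists u.
Qed.

Variables (C : category) (x y m : C) (p : mor x m) (q : mor y m).

Definition cospan_obj (i : option bool) : C :=
  match i with None => m | Some true => x | Some false => y end.

Definition cospan_leg (i : option bool) : mor (cospan_obj i) m :=
  match i with None => idm m | Some true => p | Some false => q end.

Definition cospan_map (i j : option bool) : cospan_hom i j ->
  mor (cospan_obj i) (cospan_obj j) :=
  match j with
  | None => fun=> cospan_leg i
  | Some b => fun u : i = Some b => ecast l (mor (cospan_obj i) (cospan_obj l)) u (idm _)
  end.

Definition cospan_diag : functor cospan C.
Proof.
exists cospan_obj cospan_map.
- by case=> [b|].
- move=> i j [b|] /=; last first.
    case: j => [b|] g; last by move=> f; rewrite /= cat_comp1m.
    by move=> /= f; subst i; rewrite /= cat_compm1.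
  by move=> g; subst j => f; rewrite /= cat_comp1m.
Defined.

Definition cospan_cone_leg z (f : mor z x) (g : mor z y) (i : option bool) :
  mor z (cospan_obj i) :=
  match i with None => p \oc f | Some true => f | Some false => g end.

Lemma cospan_cone_legP z (f : mor z x) (g : mor z y) (e : p \oc f = q \oc g)
  (i j : cospan) (u : mor i j) :
  fmap cospan_diag u \oc cospan_cone_leg f g i = cospan_cone_leg f g j.
Proof.
case: j u => [b|] /= u; first by subst i; rewrite /= cat_comp1m.
by case: i u => [[]|] //= _; rewrite cat_comp1m.
Qed.

Lemma pullback_exists : has_finite_limits C -> inhabited (pullback p q).
Proof.
move=> /(_ _ cospan_finite cospan_diag) [c lim].
have legN b : cospan_leg (Some b) \oc leg c (Some b) = leg c None.
  exact: (@legP _ _ _ c (Some b) None tt).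
have ex z (f : mor z x) (g : mor z y) (e : p \oc f = q \oc g) :
    exists h : mor z (apex c), leg c (Some true) \oc h = f /\ leg c (Some false) \oc h = g.
  have [h [hP _]] := lim (Cone (cospan_cone_legP e)).
  by exists h; split; [exact: (hP (Some true)) | exact: (hP (Some false))].
constructor; exists (apex c) (leg c (Some true)) (leg c (Some false))
  (fun z f g e => sval (cid (ex z f g e))).
- exact: etrans (legN true) (esym (legN false)).
- by move=> z f g e; case: (svalP (cid (ex z f g e))).
- by move=> z f g e; case: (svalP (cid (ex z f g e))).
move=> z f g e1 e2.
pose c' := @Cone _ _ cospan_diag z (fun j => leg c j \oc g)
  (fun i j u => etrans (cat_compA _ _ _) (congr1 (fun h => h \oc g) (legP c u))).
have [h [_ hU]] := lim c'.
rewrite -(hU g) //; apply/esym/hU => -[[]|] //=.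
by rewrite -(legN true) -!cat_compA; congr (_ \oc _).
Qed.

End Pullbacks.

Section SliceProducts.
Variables (C : category) (limC : has_finite_limits C) (m : C).
Implicit Types x y z : slice m.

Definition slice_pb x y : pullback (slice_map x) (slice_map y) :=
  sval (cid (let: inhabits pb := pullback_exists (slice_map x) (slice_map y) limC in
             ex_intro (fun=> True) pb I)).

Definition slice_term : slice m := SliceObj (idm m).

Definition slice_bang x : mor x slice_term :=
  @SliceHom C m x slice_term (slice_map x) (cat_comp1m (slice_map x)).

Definition slice_prod x y : slice m := SliceObj (slice_map x \oc pb1 (slice_pb x y)).

Definition slice_pr1 x y : mor (slice_prod x y) x :=
  @SliceHom C m (slice_prod x y) x (pb1 (slice_pb x y)) erefl.

Definition slice_pr2 x y : mor (slice_prod x y) y :=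
  @SliceHom C m (slice_prod x y) y (pb2 (slice_pb x y)) (esym (pbP (slice_pb x y))).

Definition slice_pair z x y (f : mor z x) (g : mor z y) : mor z (slice_prod x y).
Proof.
exists (pb_pair (slice_pb x y) (etrans (slice_funP f) (esym (slice_funP g)))).
by rewrite /= -cat_compA pb1_pair slice_funP.
Defined.

Definition slice_products : finite_products (slice m).
Proof.
refine (@FiniteProducts _ slice_term slice_bang _
  slice_prod slice_pr1 slice_pr2 slice_pair _ _ _).
- move=> x f g; apply: slice_hom_eq.
  by have := slice_funP f; have := slice_funP g; rewrite /= !cat_comp1m => -> ->.
- by move=> z x y f g; apply: slice_hom_eq; rewrite /= pb1_pair.
- by move=> z x y f g; apply: slice_hom_eq; rewrite /= pb2_pair.
- move=> z x y f g e1 e2; apply: slice_hom_eq.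
  apply: (@pb_uniq _ _ _ _ _ _ (slice_pb x y)).
    exact: (congr1 (@slice_fun _ _ _ _) e1).
  exact: (congr1 (@slice_fun _ _ _ _) e2).
Defined.

End SliceProducts.

(** [pr1 \oc pr1], [pr2 \oc pr1] and [pr2] are the three projections of
    [(E * E) * E]. *)
Record module_object (k : comPzRingType) (C : category) (P : finite_products C)
    (E : C) (add : mor (cprod P E E) E) (zero : mor (term P) E) (opp : mor E E)
    (smul : k -> mor E E) : Prop := ModuleObject {
  mo_addA : add \oc prod_map P add (idm E) =
            add \oc cpair (pr1 \oc pr1) (add \oc cpair (pr2 \oc pr1) pr2);
  mo_addC : add \oc cpair pr2 pr1 = add;
  mo_add0 : add \oc cpair (zero \oc bang P E) (idm E) = idm E;
  mo_addN : add \oc cpair opp (idm E) = zero \oc bang P E;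
  mo_smul1 : smul 1 = idm E;
  mo_smulA : forall c d, smul (c * d) = smul c \oc smul d;
  mo_smulDl : forall c d, smul (c + d) = add \oc cpair (smul c) (smul d);
  mo_smulDr : forall c, smul c \oc add = add \oc prod_map P (smul c) (smul c) }.

Record algebra_object (k : comPzRingType) (C : category) (P : finite_products C) :=
  AlgebraObject {
  ao :> C;
  ao_add : mor (cprod P ao ao) ao;
  ao_zero : mor (term P) ao;
  ao_opp : mor ao ao;
  ao_smul : k -> mor ao ao;
  ao_mul : mor (cprod P ao ao) ao;
  ao_one : mor (term P) ao;
  ao_module : module_object ao_add ao_zero ao_opp ao_smul;
  ao_mulA : ao_mul \oc prod_map P ao_mul (idm ao) =
            ao_mul \oc cpair (pr1 \oc pr1) (ao_mul \oc cpair (pr2 \oc pr1) pr2);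
  ao_mulC : ao_mul \oc cpair pr2 pr1 = ao_mul;
  ao_mul1 : ao_mul \oc cpair (ao_one \oc bang P ao) (idm ao) = idm ao;
  ao_mulDl : ao_mul \oc prod_map P ao_add (idm ao) =
             ao_add \oc cpair (ao_mul \oc cpair (pr1 \oc pr1) pr2)
                              (ao_mul \oc cpair (pr2 \oc pr1) pr2);
  ao_smul_mul : forall c,
    ao_smul c \oc ao_mul = ao_mul \oc prod_map P (ao_smul c) (idm ao) }.

(** The generalized points [X -> R] of an algebra object form an ordinary
    commutative [k]-algebra [points_calg R X]. *)
Definition points (k : comPzRingType) (C : category) (P : finite_products C)
  (R : algebra_object k P) (X : C) : Type := mor X R.

Section Points.
Variables (k : comPzRingType) (C : category) (P : finite_products C).
Variables (R : algebra_object k P) (X : C).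

HB.instance Definition _ := gen_eqMixin (points R X).
HB.instance Definition _ := gen_choiceMixin (points R X).

Implicit Types f g h : points R X.

Definition pts_add f g : points R X := ao_add R \oc cpair f g.
Definition pts_zero : points R X := ao_zero R \oc bang P X.
Definition pts_opp f : points R X := ao_opp R \oc f.
Definition pts_mul f g : points R X := ao_mul R \oc cpair f g.
Definition pts_one : points R X := ao_one R \oc bang P X.
Definition pts_in (c : k) : points R X := ao_smul R c \oc pts_one.

Lemma cpair_comp Z Y x y (f : mor Y x) (g : mor Y y) (h : mor Z Y) :
  cpair f g \oc h = cpair (f \oc h) (g \oc h) :> mor Z (cprod P x y).
Proof. by apply: pair_uniq; rewrite cat_compA ?pr1_pair ?pr2_pair. Qed.

Lemma bang_comp Z Y (h : mor Z Y) : bang P Y \oc h = bang P Z.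
Proof. exact: bang_uniq. Qed.

Definition cpair_simp := (cpair_comp, pr1_pair, pr2_pair, bang_comp, cat_comp1m, cat_compm1).

Lemma pts_addA : associative pts_add.
Proof.
move=> f g h; have := congr1 (fun u => u \oc cpair (cpair f g) h) (mo_addA (ao_module R)).
by rewrite /prod_map /pts_add; do !rewrite -?cat_compA ?cpair_simp.
Qed.

Lemma pts_addC : commutative pts_add.
Proof.
move=> f g; have := congr1 (fun u => u \oc cpair g f) (mo_addC (ao_module R)).
by rewrite /pts_add; do !rewrite -?cat_compA ?cpair_simp.
Qed.

Lemma pts_add0 : left_id pts_zero pts_add.
Proof.
move=> f; have := congr1 (fun u => u \oc f) (mo_add0 (ao_module R)).
by rewrite /pts_add /pts_zero; do !rewrite -?cat_compA ?cpair_simp.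
Qed.

Lemma pts_addN : left_inverse pts_zero pts_opp pts_add.
Proof.
move=> f; have := congr1 (fun u => u \oc f) (mo_addN (ao_module R)).
by rewrite /pts_add /pts_opp /pts_zero; do !rewrite -?cat_compA ?cpair_simp.
Qed.

HB.instance Definition _ := GRing.isZmodule.Build (points R X)
  pts_addA pts_addC pts_add0 pts_addN.

Lemma pts_mulA : associative pts_mul.
Proof.
move=> f g h; have := congr1 (fun u => u \oc cpair (cpair f g) h) (ao_mulA R).
by rewrite /prod_map /pts_mul; do !rewrite -?cat_compA ?cpair_simp.
Qed.

Lemma pts_mulC : commutative pts_mul.
Proof.
move=> f g; have := congr1 (fun u => u \oc cpair g f) (ao_mulC R).
by rewrite /pts_mul; do !rewrite -?cat_compA ?cpair_simp.
Qed.

Lemma pts_mul1 : left_id pts_one pts_mul.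
Proof.
move=> f; have := congr1 (fun u => u \oc f) (ao_mul1 R).
by rewrite /pts_mul /pts_one; do !rewrite -?cat_compA ?cpair_simp.
Qed.

Lemma pts_mulDl : left_distributive pts_mul +%R.
Proof.
move=> f g h; have := congr1 (fun u => u \oc cpair (cpair f g) h) (ao_mulDl R).
rewrite /+%R /= /prod_map /pts_mul /pts_add; by do !rewrite -?cat_compA ?cpair_simp.
Qed.

HB.instance Definition _ := GRing.Zmodule_isComPzRing.Build (points R X)
  pts_mulA pts_mulC pts_mul1 pts_mulDl.

Lemma pts_inD c d : pts_in (c + d) = pts_in c + pts_in d.
Proof.
by rewrite /pts_in (mo_smulDl (ao_module R)) /+%R /= /pts_add -cat_compA cpair_simp.
Qed.

Lemma pts_in_zmod : zmod_morphism pts_in.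
Proof. by move=> c d; apply: (addIr (pts_in d)); rewrite -pts_inD !subrK. Qed.

Lemma pts_in_monoid : monoid_morphism pts_in.
Proof.
split=> [|c d]; first by rewrite /pts_in (mo_smul1 (ao_module R)) cat_comp1m.
have E f g : pts_mul (ao_smul R c \oc f) g = ao_smul R c \oc pts_mul f g.
  by rewrite /pts_mul cat_compA ao_smul_mul /prod_map; do !rewrite -?cat_compA ?cpair_simp.
rewrite /pts_in (mo_smulA (ao_module R)) -cat_compA.
by rewrite -[X in _ \oc X](pts_mul1 (ao_smul R d \oc pts_one)) -E.
Qed.

HB.instance Definition _ := GRing.isZmodMorphism.Build _ _ pts_in pts_in_zmod.
HB.instance Definition _ := GRing.isMonoidMorphism.Build _ _ pts_in pts_in_monoid.

Definition points_calg : calg k := @CAlg k (points R X) pts_in.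

End Points.

Definition calg_cat (k : comPzRingType) : category.
Proof.
exists (calg k) (@calg_hom k) (@calg_id k) (@calg_comp k) => *; exact: calg_hom_eq.
Defined.

Definition weil_cat (k : comPzRingType) : category.
Proof.
exists (weil k) (@weil_hom k) (@weil_id k) (@weil_comp k) => *; exact: weil_hom_eq.
Defined.

Definition weil_forget (k : comPzRingType) : functor (weil_cat k) (calg_cat k).
Proof.
by exists (fun W : weil k => weil_calg W) (fun W1 W2 (f : weil_hom W1 W2) => weil_hom_calg f).
Defined.

(** [dg_T W X] is [X (x) W] and [dg_alpha f X] is [id_X (x) f].

    The identifications [T^k = id] and [T^W2 o T^W1 = T^(W1 (x) W2)] are natural
    isomorphisms [dg_unit] (with inverse [dg_unitV]) and [dg_mul], coherent with
    the unit and associativity isomorphisms of the tensor product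
    ([dg_mul_unitr], [dg_mul_unitl], [dg_mul_assoc]); when [T] and [(x)] are strict
    they are identities.  [dg_alpha_T] and [dg_T_alpha] are the compatibility of
    [alpha] with tensor products.

    The identification [T^W R = R (x)_k W] is the bijection [dg_TR], natural in
    [X], between the points [X -> T^W R] and [Hom(X, R) (x)_k W] (the Yoneda
    description of the algebra object [R (x)_k W]).  It is an isomorphism of
    [k]-algebras: since [T^W] preserves products, a pair of points of [T^W R] is a
    point of [T^W (R * R)], on which the operations of [T^W R] act through [T^W]
    of those of [R].  [dg_TR_unit] identifies it at [W = k] with [dg_unit], and
    [dg_TR_alpha] says that [alpha_f (R)] is [id_R (x) f]. *)
Record DG_category (k : comPzRingType) := DGCategory {
  dg_cat :> category;
  dg_lim : has_finite_limits dg_cat;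
  dg_prod : finite_products dg_cat;
  dg_exp : exponentials dg_prod;
  dg_R : algebra_object k dg_prod;

  dg_T : weil k -> functor dg_cat dg_cat;
  dg_lex : forall W, left_exact (dg_T W);
  dg_alpha : forall W1 W2 : weil k, weil_hom W1 W2 -> nat_trans (dg_T W1) (dg_T W2);
  dg_alpha1 : forall (W : weil k) (X : dg_cat),
    dg_alpha (weil_id W) X = idm (dg_T W X);
  dg_alphaM : forall (W1 W2 W3 : weil k) (g : weil_hom W2 W3) (f : weil_hom W1 W2)
    (X : dg_cat), dg_alpha (weil_comp g f) X = dg_alpha g X \oc dg_alpha f X;

  dg_unit : nat_trans (functor_id dg_cat) (dg_T (weil_base k));
  dg_unitV : nat_trans (dg_T (weil_base k)) (functor_id dg_cat);
  dg_unitK : forall X, inverse_of (dg_unit X) (dg_unitV X);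

  dg_mul : forall W1 W2 : weil k,
    nat_trans (functor_comp (dg_T W2) (dg_T W1)) (dg_T (weil_tens W1 W2));
  dg_mul_iso : forall (W1 W2 : weil k) (X : dg_cat), is_iso (dg_mul W1 W2 X);

  dg_mul_unitr : forall (W : weil k) (X : dg_cat),
    dg_alpha (weil_unitr W) X \oc dg_mul W (weil_base k) X \oc dg_unit (dg_T W X)
    = idm (dg_T W X);
  dg_mul_unitl : forall (W : weil k) (X : dg_cat),
    dg_alpha (weil_unitl W) X \oc dg_mul (weil_base k) W X \oc fmap (dg_T W) (dg_unit X)
    = idm (dg_T W X);
  dg_mul_assoc : forall (W1 W2 W3 : weil k) (X : dg_cat),
    dg_alpha (weil_assoc W1 W2 W3) X \oc dg_mul (weil_tens W1 W2) W3 X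
      \oc fmap (dg_T W3) (dg_mul W1 W2 X)
    = dg_mul W1 (weil_tens W2 W3) X \oc dg_mul W2 W3 (dg_T W1 X);

  dg_alpha_T : forall (W W1 W2 : weil k) (f : weil_hom W1 W2) (X : dg_cat),
    dg_mul W2 W X \oc fmap (dg_T W) (dg_alpha f X)
    = dg_alpha (weil_map f (weil_id W)) X \oc dg_mul W1 W X;
  dg_T_alpha : forall (W W1 W2 : weil k) (f : weil_hom W1 W2) (X : dg_cat),
    dg_mul W W2 X \oc dg_alpha f (dg_T W X)
    = dg_alpha (weil_map (weil_id W) f) X \oc dg_mul W W1 X;

  dg_TR : forall (W : weil k) (X : dg_cat),
    mor X (dg_T W dg_R) -> calg_tens (points_calg dg_R X) W;
  dg_TR_bij : forall W X, bijective (@dg_TR W X);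
  dg_TR_nat : forall (W : weil k) (X Y : dg_cat) (h : mor Y X) (f : mor X (dg_T W dg_R)) i,
    dg_TR (f \oc h) i = dg_TR f i \oc h :> mor Y dg_R;
  dg_TR_add : forall (W : weil k) (X : dg_cat)
      (f : mor X (dg_T W (cprod dg_prod dg_R dg_R))),
    dg_TR (fmap (dg_T W) (ao_add dg_R) \oc f) =
    dg_TR (fmap (dg_T W) pr1 \oc f) + dg_TR (fmap (dg_T W) pr2 \oc f);
  dg_TR_mul : forall (W : weil k) (X : dg_cat)
      (f : mor X (dg_T W (cprod dg_prod dg_R dg_R))),
    dg_TR (fmap (dg_T W) (ao_mul dg_R) \oc f) =
    dg_TR (fmap (dg_T W) pr1 \oc f) * dg_TR (fmap (dg_T W) pr2 \oc f);
  dg_TR_one : forall (W : weil k) (X : dg_cat) (f : mor X (dg_T W (term dg_prod))),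
    dg_TR (fmap (dg_T W) (ao_one dg_R) \oc f) = 1;
  dg_TR_smul : forall (W : weil k) (X : dg_cat) (c : k) (f : mor X (dg_T W dg_R)),
    dg_TR (fmap (dg_T W) (ao_smul dg_R c) \oc f)
    = calg_in (calg_tens (points_calg dg_R X) W) c * dg_TR f;
  dg_TR_unit : forall (X : dg_cat) (f : mor X dg_R),
    dg_TR (dg_unit dg_R \oc f) = tens_inl (points_calg dg_R X) (weil_base k) f;
  dg_TR_alpha : forall (W1 W2 : weil k) (phi : weil_hom W1 W2) (X : dg_cat)
      (f : mor X (dg_T W1 dg_R)),
    dg_TR (dg_alpha phi dg_R \oc f) =
    calg_tens_map (points_calg dg_R X) phi (dg_TR f) }.

Section Tangent.
Variables (k : comPzRingType) (K : DG_category k).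
Implicit Types (W : weil k) (X N M : K).

Definition dg_act M : functor (weil_cat k) K.
Proof.
exists (fun W : weil k => dg_T K W M)
  (fun (W1 W2 : weil k) (f : weil_hom W1 W2) => dg_alpha K f M).
- by move=> W; apply: dg_alpha1.
- by move=> W1 W2 W3 g f; apply: dg_alphaM.
Defined.

(** A limit diagram of Weil algebras is, as usual for microlinearity, a cone of
    Weil algebras that is a limit of [k]-algebras.  Bare limits in the category of
    augmented algebras would be too many: there [k] is the limit of the empty
    diagram, so that preserving them all would force [M (x) k = M] to be terminal.
    (Over a non-trivial [k], the cones retained here are limit cones in that
    category too, so this hypothesis is the weaker of the two.) *)
Definition microlinear M : Prop :=
  forall J : category, finite_category J ->
  forall (F : functor J (weil_cat k)) (c : cone F),
    is_limit (map_cone (weil_forget k) c) -> is_limit (map_cone (dg_act M) c).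

Definition dg_inj W X : mor X (dg_T K W X) :=
  dg_alpha K (weil_unit W) X \oc dg_unit K X.

Definition dg_tau W X : mor (dg_T K W X) X :=
  dg_unitV K X \oc dg_alpha K (weil_augm W) X.

(** [(X (x) W) * N -> (X * N) (x) W], from [N -> N (x) W]. *)
Definition dg_strength W X N :
  mor (cprod (dg_prod K) (dg_T K W X) N) (dg_T K W (cprod (dg_prod K) X N)) :=
  lex_pair (dg_prod K) (@dg_lex k K W) pr1 (dg_inj W N \oc pr2).

(** The canonical morphism [(M (x) W1)^N (x) W2 -> (M (x) (W1 (x) W2))^N]. *)
Definition weil_exp_map M N W1 W2 :
  mor (dg_T K W2 (cexp (dg_exp K) (dg_T K W1 M) N))
      (cexp (dg_exp K) (dg_T K (weil_tens W1 W2) M) N) :=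
  cat_curry (dg_exp K) (dg_mul K W1 W2 M
    \oc fmap (dg_T K W2) (ev (dg_exp K) (dg_T K W1 M) N)
    \oc dg_strength W2 (cexp (dg_exp K) (dg_T K W1 M) N) N).

Definition weil_exponentiable M : Prop :=
  forall N W1 W2, is_iso (weil_exp_map M N W1 W2).

(** [tau_W (M)] as an object of the slice over [M]. *)
Definition dg_over M W : slice M := SliceObj (dg_tau W M).

Definition dg_over_map M W1 W2 (f : weil_hom W1 W2) : mor (dg_over M W1) (dg_over M W2).
Proof.
exists (dg_alpha K f M); rewrite /= /dg_tau -cat_compA -dg_alphaM.
by congr (_ \oc dg_alpha K _ M); apply: weil_hom_eq => x; apply: weil_hom_aug.
Defined.

Definition dg_over_unit M W : mor (slice_term M) (dg_over M W).
Proof.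
exists (dg_inj W M); rewrite /= /dg_tau /dg_inj -cat_compA.
rewrite [X in _ \oc X]cat_compA -dg_alphaM.
have -> : weil_comp (weil_augm W) (weil_unit W) = weil_id (weil_base k).
  by apply: weil_hom_eq => x; apply: calg_hom_in.
by rewrite dg_alpha1 cat_comp1m; case: (dg_unitK M).
Defined.

Definition tangent_prod M : finite_products (slice M) := slice_products (@dg_lim k K) M.

Definition tangent M : slice M := dg_over M (WD k 1).

(** Dual to [d |-> (d, d)]. *)
Definition tangent_add M : mor (dg_over M (WD k 2)) (tangent M) :=
  dg_over_map M (WD_lin (fun _ : 'I_2 => 1)).

(** Dual to [D -> 1]. *)
Definition tangent_zero M : mor (term (tangent_prod M)) (tangent M) :=
  dg_over_unit M (WD k 1).

Definition tangent_opp M : mor (tangent M) (tangent M) :=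
  dg_over_map M (WD_lin (fun _ : 'I_1 => -1)).

Definition tangent_smul M (xi : k) : mor (tangent M) (tangent M) :=
  dg_over_map M (WD_lin (fun _ : 'I_1 => xi)).

(** Paired from the duals of [d |-> (d, 0)] and [d |-> (0, d)]. *)
Definition tangent_ident M :
  mor (dg_over M (WD k 2)) (cprod (tangent_prod M) (tangent M) (tangent M)) :=
  cpair (dg_over_map M (WD_lin (fun j : 'I_2 => (j == ord0)%:R)))
        (dg_over_map M (WD_lin (fun j : 'I_2 => (j == ord_max)%:R))).

End Tangent.

(* Main.v *)
(** Linear maps between the [k ^ n] act on the algebras [WD k n] ([WD_mx]), and
    [WD k (n + m)] is the fibre product of [WD k n] and [WD k m] over [k].
    Microlinearity turns this into products in the slice over [M], so that any
    two or three points of the tangent bundle come from a single point [t] of some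
    [M (x) WD k n] by means of column vectors.  On the points that come from [t]
    the operations are those of column vectors, where the module axioms are
    evident. *)

Require Import Defs.
From mathcomp Require Import all_boot all_algebra.

Import GRing.Theory.
Local Open Scope ring_scope.
Set Implicit Arguments.
Unset Strict Implicit.
Unset Printing Implicit Defensive.

(** * Matrices acting on the Weil algebras of the [D(n)] *)

Section LinearWeil.
Variable k : comPzRingType.

Section Matrix.
Variables (n m : nat) (A : 'M[k]_(n, m)).

(** Nilpotent parts are rows, so this substitutes [\sum_j A i j X_j] for [X_i]; it is dual to the
    linear map [d |-> A d] from [D(m)] to [D(n)], with [d] a column. *)
Definition WD_mx_fun (x : WD k n) : WD k m := (x.1, x.2 *m A).

Lemma WD_mx_funD : {morph WD_mx_fun : x y / x + y}.
Proof. by move=> x y; rewrite /WD_mx_fun mulmxDl. Qed.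

Lemma WD_mx_funM : {morph WD_mx_fun : x y / x * y}.
Proof. by move=> x y; rewrite /WD_mx_fun mulmxDl -!scalemxAl. Qed.

Lemma WD_mx_fun_in c : WD_mx_fun (calg_in (WD k n) c) = calg_in (WD k m) c.
Proof. by rewrite /WD_mx_fun mul0mx. Qed.

Definition WD_mx : weil_hom (WD k n) (WD k m) :=
  @WeilHom k (WD k n) (WD k m) (CAlgHom WD_mx_funD WD_mx_funM WD_mx_fun_in)
    (fun=> erefl).

End Matrix.

Lemma WD_mx1 n : WD_mx 1%:M = weil_id (WD k n).
Proof. by apply: weil_hom_eq => -[a v]; rewrite /= /WD_mx_fun mulmx1. Qed.

Lemma WD_mxM n m p (A : 'M[k]_(n, m)) (B : 'M[k]_(m, p)) :
  WD_mx (A *m B) = weil_comp (WD_mx B) (WD_mx A).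
Proof. by apply: weil_hom_eq => x; rewrite /= /WD_mx_fun mulmxA. Qed.

Lemma WD_mx0 n m :
  WD_mx (0 : 'M[k]_(n, m)) = weil_comp (weil_unit (WD k m)) (weil_augm (WD k n)).
Proof. by apply: weil_hom_eq => x; rewrite /= /WD_mx_fun mulmx0. Qed.

Lemma WD_linE n (c : 'I_n -> k) : WD_lin c = WD_mx (\col_j c j).
Proof.
apply: weil_hom_eq => x.
rewrite /= /WD_subst_fun /WD_mx_fun.
under eq_bigr do rewrite !WD_inE /=  !mulr0 scalerA.
rewrite WD_sum /= big1 //; congr pair; rewrite /= ?addr0 // add0r.
apply/rowP=> i; rewrite summxE mxE; apply: eq_bigr => j _.
by rewrite !mxE (ord1 i) mulr1.
Qed.

(** Dual to the inclusions [d |-> (d, 0)] and [d |-> (0, d)] of [D(n)] and [D(m)] into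
    [D(n + m)]. *)
Definition WD_fst n m : weil_hom (WD k (n + m)) (WD k n) := WD_mx (col_mx 1%:M 0).
Definition WD_snd n m : weil_hom (WD k (n + m)) (WD k m) := WD_mx (col_mx 0 1%:M).

Definition weil_cospan (W1 W2 : weil k) : functor cospan (weil_cat k) :=
  @cospan_diag (weil_cat k) W1 W2 (weil_base k) (weil_augm W1) (weil_augm W2).

Lemma weil_augm_comp (W V : weil k) (f : weil_hom W V) :
  weil_comp (weil_augm V) f = weil_augm W.
Proof. by apply: weil_hom_eq => x; apply: weil_hom_aug. Qed.

Definition weil_cospan_cone (W W1 W2 : weil k)
    (f : weil_hom W W1) (g : weil_hom W W2) : cone (weil_cospan W1 W2) :=
  Cone (@cospan_cone_legP (weil_cat k) _ _ _ _ _ W f g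
    (etrans (weil_augm_comp f) (esym (weil_augm_comp g)))).

(** Nilpotent parts enter a product only scaled by scalar parts, so rows over a common scalar part
    can be concatenated multiplicatively. *)
Lemma WD_prod_limit n m :
  is_limit (map_cone (weil_forget k) (weil_cospan_cone (WD_fst n m) (WD_snd n m))).
Proof.
move=> c'; pose A : calg k := apex c'.
pose f : calg_hom A (WD k n) := leg c' (Some true).
pose g : calg_hom A (WD k m) := leg c' (Some false).
have fN (a : A) : (f a).1 = (leg c' None : calg_hom _ _) a.
  by rewrite -(@legP _ _ _ c' (Some true) None tt).
have gN (a : A) : (g a).1 = (leg c' None : calg_hom _ _) a.
  by rewrite -(@legP _ _ _ c' (Some false) None tt).
(* Equality of the scalar parts is what makes [h] below multiplicative. *)
have fg a : (g a).1 = (f a).1 by rewrite fN gN.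
pose h (a : A) : WD k (n + m) := ((f a).1, row_mx (f a).2 (g a).2).
have hD : {morph h : a b / a + b}.
  by move=> a b; rewrite /h !calg_homD; congr pair; rewrite /= add_row_mx.
have hM : {morph h : a b / a * b}.
  move=> a b; rewrite /h !calg_homM; congr pair.
  by rewrite /= !fg !scale_row_mx add_row_mx.
have h_in c : h (calg_in A c) = calg_in (WD k (n + m)) c.
  by rewrite /h !calg_hom_in; congr pair; rewrite /= row_mx0.
exists (CAlgHom hD hM h_in : mor (apex c') (WD_calg k (n + m) : calg_cat k)); split.
  case=> [[]|]; apply: calg_hom_eq => a.
  - rewrite /= /WD_mx_fun /h /= mul_row_col mulmx1 mulmx0 addr0.
    by rewrite -surjective_pairing.
  - rewrite /= /WD_mx_fun /h /= mul_row_col mulmx1 mulmx0 add0r -fg.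
    by rewrite -surjective_pairing.
  - exact: fN.
move=> h' h'P; apply: calg_hom_eq => a.
have := congr1 (fun u : calg_hom A (WD k n) => u a) (h'P (Some true)).
have := congr1 (fun u : calg_hom A (WD k m) => u a) (h'P (Some false)).
rewrite /= /h -/f -/g => <- <- /=.
(* The matrices of the two projections, side by side, form the identity matrix, so the projections
   determine [v]. *)
case: ((h' : calg_hom _ _) a) => b v; rewrite /WD_mx_fun /= -mul_mx_row.
by rewrite -block_mxEh -scalar_mx_block mulmx1.
Qed.

End LinearWeil.

(** * Products over [M] and tangent vectors given by columns *)

Section TangentBundle.
Variables (k : comPzRingType) (K : DG_category k) (M : K).
Implicit Types X : slice M.

Lemma dg_over_mapM (W1 W2 W3 : weil k) (g : weil_hom W2 W3) (f : weil_hom W1 W2) :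
  dg_over_map M (weil_comp g f) = dg_over_map M g \oc dg_over_map M f.
Proof. by apply: slice_hom_eq; apply: dg_alphaM. Qed.

Lemma dg_over_map1 (W : weil k) : dg_over_map M (weil_id W) = idm (dg_over M W).
Proof. by apply: slice_hom_eq; apply: dg_alpha1. Qed.

Lemma dg_unitV_inj (Y : K) (u v : mor Y (dg_T K (weil_base k) M)) :
  dg_unitV K M \oc u = dg_unitV K M \oc v -> u = v.
Proof.
have [_ VK] := dg_unitK M.
by move=> /(congr1 (fun w => dg_unit K M \oc w)); rewrite !cat_compA VK !cat_comp1m.
Qed.

(** Microlinearity yields a pullback over [M (x) k]; it is a product in the slice because [dg_unitV]
    identifies [M (x) k] with [M]. *)
Lemma dg_over_prod (W W1 W2 : weil k) (p : weil_hom W W1) (q : weil_hom W W2) :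
  microlinear M -> is_limit (map_cone (weil_forget k) (weil_cospan_cone p q)) ->
  forall X (f : mor X (dg_over M W1)) (g : mor X (dg_over M W2)),
  exists! h : mor X (dg_over M W), dg_over_map M p \oc h = f /\ dg_over_map M q \oc h = g.
Proof.
move=> /(_ _ cospan_finite) mic /mic lim X f g.
pose fg (i : cospan) : mor (slice_dom X) (functor_comp (dg_act M) (weil_cospan W1 W2) i) :=
  match i with
  | None => dg_alpha K (weil_augm W1) M \oc slice_fun f
  | Some true => slice_fun f
  | Some false => slice_fun g
  end.
have fgP (i j : cospan) (u : mor i j) :
    fmap (functor_comp (dg_act M) (weil_cospan W1 W2)) u \oc fg i = fg j.
  case: j u => [b|] /= u; first by subst i; rewrite /= dg_alpha1 cat_comp1m.
  case: i u => [[]|] //= _; last by rewrite dg_alpha1 cat_comp1m.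
  (* The composites to [M (x) k] agree because [dg_unitV] turns both into the structure map of
     [X]. *)
  apply: dg_unitV_inj; rewrite !cat_compA.
  exact: etrans (slice_funP g) (esym (slice_funP f)).
have [h [hP hU]] := lim (Cone fgP).
have h1 : dg_alpha K p M \oc h = slice_fun f := hP (Some true).
have h2 : dg_alpha K q M \oc h = slice_fun g := hP (Some false).
have hX : slice_map (dg_over M W) \oc h = slice_map X.
  by rewrite -(slice_funP (dg_over_map M p)) -cat_compA h1 slice_funP.
exists (SliceHom hX : mor X (dg_over M W)); split; first by split; apply: slice_hom_eq.
move=> h' [/(congr1 (@slice_fun _ _ _ _)) /= e1 /(congr1 (@slice_fun _ _ _ _)) /= e2].
apply: slice_hom_eq; apply: hU => -[[]|] //=.
by rewrite dg_alphaM -cat_compA e1.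
Qed.

(** Think of [t] as [n] tangent vectors with a common base point and of this as their linear
    combination with coefficients [A]: it restricts [t] along the line [d |-> d A] in [D(n)]. *)
Definition tangent_col n (X : slice M) (t : mor X (dg_over M (WD k n)))
  (A : 'cV[k]_n) : mor X (tangent M) := dg_over_map M (WD_mx A) \oc t.

Lemma tangent_col1 X (f : mor X (tangent M)) : tangent_col f 1%:M = f.
Proof. by rewrite /tangent_col WD_mx1 dg_over_map1 cat_comp1m. Qed.

Lemma tangent_colM n m X (t : mor X (dg_over M (WD k n))) (A : 'M[k]_(n, m)) B :
  tangent_col (dg_over_map M (WD_mx A) \oc t) B = tangent_col t (A *m B).
Proof. by rewrite /tangent_col cat_compA -dg_over_mapM -WD_mxM. Qed.

(** The zero column factors through the augmentation, so only the base point of [t] is left, and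
    that is the structure map of [X]. *)
Lemma tangent_col_zero n X (t : mor X (dg_over M (WD k n))) :
  tangent_zero M \oc bang (tangent_prod M) X = tangent_col t 0.
Proof.
rewrite /tangent_col WD_mx0 dg_over_mapM; apply: slice_hom_eq.
rewrite /= /dg_inj -!cat_compA; congr (_ \oc _).
apply: dg_unitV_inj; rewrite !cat_compA.
have [-> _] := dg_unitK M; rewrite cat_comp1m.
by rewrite -(slice_funP t).
Qed.

Lemma tangent_col_smul n X (t : mor X (dg_over M (WD k n))) A c :
  tangent_smul M c \oc tangent_col t A = tangent_col t (c *: A).
Proof.
rewrite /tangent_smul WD_linE.
(* Scaling is the action of a 1 by 1 matrix, so the left side is again a [tangent_col]. *)
rewrite -[LHS]/(tangent_col (dg_over_map M (WD_mx A) \oc t) _) tangent_colM.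
have -> : \col_(_ < 1) c = c%:M by apply/matrixP=> i j; rewrite !mxE !ord1.
by rewrite mul_mx_scalar.
Qed.

Section Products.
Hypothesis mic : microlinear M.

Lemma tangent_join n m X (f : mor X (dg_over M (WD k n))) (g : mor X (dg_over M (WD k m))) :
  exists! h : mor X (dg_over M (WD k (n + m))),
    dg_over_map M (WD_fst k n m) \oc h = f /\ dg_over_map M (WD_snd k n m) \oc h = g.
Proof. exact: dg_over_prod mic (@WD_prod_limit k n m) X f g. Qed.

Lemma tangent_pair X (f g : mor X (tangent M)) :
  exists (t : mor X (dg_over M (WD k 2))) A B,
    f = tangent_col t A /\ g = tangent_col t B.
Proof.
have [t [[<- <-] _]] := @tangent_join 1 1 X f g.
(* The two unit columns pick out the components of [t]. *)
by exists t, (col_mx 1%:M 0 : 'cV_(1 + 1)), (col_mx 0 1%:M : 'cV_(1 + 1)).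
Qed.

Lemma tangent_triple X (f g h : mor X (tangent M)) :
  exists (t : mor X (dg_over M (WD k 3))) A B C,
    [/\ f = tangent_col t A, g = tangent_col t B & h = tangent_col t C].
Proof.
have [s [A [B [-> ->]]]] := tangent_pair f g.
have [t [[<- <-] _]] := @tangent_join 2 1 X s h.
(* [P] pads a column for [s] with a zero, which gives a column for [t]. *)
pose P : 'M[k]_(2 + 1, 2) := col_mx 1%:M 0.
by exists t, (P *m A), (P *m B), (col_mx 0 1%:M : 'cV_(2 + 1));
  rewrite -!tangent_colM.
Qed.

(** In this form the universal property [tangent_join] applies. *)
Lemma tangent_identE :
  tangent_ident M = cpair (dg_over_map M (WD_fst k 1 1)) (dg_over_map M (WD_snd k 1 1)).
Proof.
rewrite /tangent_ident !WD_linE /WD_fst /WD_snd.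
by congr (cpair (dg_over_map M (WD_mx _)) (dg_over_map M (WD_mx _)));
  apply/matrixP=> i j; rewrite !mxE; case: splitP => l; rewrite !mxE !ord1;
  case: i => [[|[]]].
Qed.

Lemma tangent_ident_iso : exists inv, inverse_of (tangent_ident M) inv.
Proof.
rewrite tangent_identE.
have [inv [[i1 i2] _]] := @tangent_join 1 1 _
  (pr1 : mor (cprod (tangent_prod M) (tangent M) (tangent M)) _) pr2.
exists inv; split; last first.
  by apply: pair_uniq; rewrite cat_compA ?pr1_pair ?pr2_pair cat_compm1.
(* The composite and the identity both mediate the cone formed by the two projections themselves,
   hence coincide. *)
have [h [_ hU]] := @tangent_join 1 1 _
  (dg_over_map M (WD_fst k 1 1)) (dg_over_map M (WD_snd k 1 1)).
rewrite -(hU (idm _)) ?cat_compm1 //; apply/esym/hU.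
by rewrite !cat_compA i1 i2 pr1_pair pr2_pair.
Qed.

Section Addition.
Variable inv : mor (cprod (tangent_prod M) (tangent M) (tangent M)) (dg_over M (WD k 2)).
Hypothesis identK : inv \oc tangent_ident M = idm _.

(** The pair comes from the point of [M (x) WD k 2] that [row_mx A B] produces from [t]; addition
    multiplies this matrix by the column of ones. *)
Lemma tangent_col_add n X (t : mor X (dg_over M (WD k n))) A B :
  tangent_add M \oc inv \oc cpair (tangent_col t A) (tangent_col t B)
  = tangent_col t (A + B).
Proof.
have -> : cpair (tangent_col t A) (tangent_col t B)
    = tangent_ident M \oc (dg_over_map M (WD_mx (row_mx A B : 'M_(n, 1 + 1))) \oc t).
  rewrite tangent_identE; apply: pair_uniq; rewrite !cat_compA ?pr1_pair ?pr2_pair.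
    rewrite -[RHS]cat_compA -[RHS]/(tangent_col _ _) tangent_colM.
    by rewrite (@mul_row_col _ n 1 1 1) mulmx1 mulmx0 addr0.
  rewrite -[RHS]cat_compA -[RHS]/(tangent_col _ _) tangent_colM.
  by rewrite (@mul_row_col _ n 1 1 1) mulmx1 mulmx0 add0r.
rewrite -[tangent_add M \oc inv \oc _]cat_compA [inv \oc _]cat_compA identK cat_comp1m.
rewrite /tangent_add WD_linE -[LHS]/(tangent_col _ _) tangent_colM.
have -> : \col_(_ < 2) 1 = col_mx 1%:M 1%:M :> 'M[k]_(1 + 1, 1).
  by apply/matrixP=> i j; rewrite !mxE; case: splitP => l _; rewrite !mxE !ord1.
by rewrite (@mul_row_col _ n 1 1 1) !mulmx1.
Qed.

End Addition.

(** * The module axioms, read off from columns *)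

Variable add : mor (cprod (tangent_prod M) (tangent M) (tangent M)) (tangent M).
Hypothesis addE : forall n X (t : mor X (dg_over M (WD k n))) A B,
  add \oc cpair (tangent_col t A) (tangent_col t B) = tangent_col t (A + B).

Lemma add_pair X (f g : mor X (tangent M)) (h : mor X (cprod (tangent_prod M) _ _)) :
  pr1 \oc h = f -> pr2 \oc h = g -> add \oc h = add \oc cpair f g.
Proof. by move=> hf hg; congr (_ \oc _); apply: pair_uniq; rewrite ?pr1_pair ?pr2_pair. Qed.

(** Each equation is tested on universal points: the projections of a product, written as columns of
    one [t], or the identity, which is the column [1%:M] of itself. *)
Lemma tangent_module :
  module_object (P := tangent_prod M) add (tangent_zero M) (tangent_opp M)
    (@tangent_smul k K M).
Proof.
split.
- set E2 := cprod _ (tangent M) (tangent M).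
  have [t [A [B [C [e1 e2 e3]]]]] := tangent_triple
    (pr1 \oc pr1 : mor (cprod (tangent_prod M) E2 (tangent M)) (tangent M)) (pr2 \oc pr1) pr2.
  rewrite /prod_map (@add_pair _ _ _ pr1 erefl erefl) e1 e2 e3 cat_comp1m.
  by rewrite !addE addrA.
- have [t [A [B [e1 e2]]]] := tangent_pair
    (pr1 : mor (cprod (tangent_prod M) (tangent M) (tangent M)) _) pr2.
  rewrite -[RHS]cat_compm1 (@add_pair _ pr1 pr2 (idm _)) ?cat_compm1 // e1 e2.
  by rewrite !addE addrC.
- rewrite -[idm _ in LHS]tangent_col1 (tangent_col_zero (idm _)).
  by rewrite addE add0r tangent_col1.
- rewrite -[tangent_opp M]cat_compm1 -[idm _]tangent_col1 (tangent_col_zero (idm _)).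
  (* [tangent_opp M] unfolds to the same morphism as [tangent_smul M (-1)]. *)
  by rewrite (tangent_col_smul _ _ (-1)) addE scaleN1r addNr.
- by rewrite -[LHS]cat_compm1 -{1}[idm _]tangent_col1 tangent_col_smul scale1r tangent_col1.
- move=> c d; rewrite -[LHS]cat_compm1 -[tangent_smul M d]cat_compm1 -[idm _]tangent_col1.
  by rewrite !tangent_col_smul scalerA.
- move=> c d; rewrite -[LHS]cat_compm1 -[tangent_smul M c]cat_compm1
    -[tangent_smul M d]cat_compm1 -[idm _]tangent_col1.
  by rewrite !tangent_col_smul addE scalerDl.
- move=> c; have [t [A [B [e1 e2]]]] := tangent_pair
    (pr1 : mor (cprod (tangent_prod M) (tangent M) (tangent M)) _) pr2.
  rewrite /prod_map -[add in LHS]cat_compm1 (@add_pair _ pr1 pr2 (idm _)) ?cat_compm1 //.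
  by rewrite e1 e2 !tangent_col_smul !addE tangent_col_smul scalerDr.
Qed.

End Products.
End TangentBundle.

Theorem theorem3 (k : comPzRingType) (K : DG_category k) (M : K) :
  microlinear M -> weil_exponentiable M ->
  exists ident_inv : mor (cprod (tangent_prod M) (tangent M) (tangent M))
                         (dg_over M (WD k 2)),
    inverse_of (tangent_ident M) ident_inv /\
    module_object (P := tangent_prod M)
      (tangent_add M \oc ident_inv) (tangent_zero M) (tangent_opp M)
      (@tangent_smul k K M).
Proof.
move=> mic _; have [inv invP] := tangent_ident_iso mic.
by exists inv; split=> //; apply: tangent_module mic _ _ => n X t A B; apply: tangent_col_add; exact: invP.1.
Qed.
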